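(* Let $G_1$ and $G_2$ be finite simple graphs, where $G_i$ has $n_i$ vertices, $m_i$ edges, minimum degree $\delta_{G_i}$ and maximum degree $\Delta_{G_i}$ ($i=1,2$). Then $\alpha_1 \leq EU(G_1+G_2)\leq \alpha_2$, where $$\alpha_1=\sqrt{3}\,m_1(\delta_{G_1}+n_2)+\sqrt{3}\,m_2(\delta_{G_2}+n_1)+n_1n_2\{(\delta_{G_1}+n_2)^2+(\delta_{G_2}+n_1)^2+(\delta_{G_1}+n_2)(\delta_{G_2}+n_1)\}^{\frac{1}{2}},$$ $$\alpha_2=\sqrt{3}\,m_1(\Delta_{G_1}+n_2)+\sqrt{3}\,m_2(\Delta_{G_2}+n_1)+n_1n_2\{(\Delta_{G_1}+n_2)^2+(\Delta_{G_2}+n_1)^2+(\Delta_{G_1}+n_2)(\Delta_{G_2}+n_1)\}^{\frac{1}{2}}.$$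
   Context: For a graph $G$ and vertex $u$, $d(u)$ denotes the degree of $u$ in $G$. The Euler Sombor index of a graph $G$ is $EU(G)=\sum_{uv\in E(G)}\sqrt{d(u)^2+d(v)^2+d(u)d(v)}$. The join $G_1+G_2$ of graphs $G_1=(V_1,E_1)$ and $G_2=(V_2,E_2)$ (with disjoint vertex sets) is the graph with vertex set $V_1\cup V_2$ and edge set $E_1\cup E_2\cup\{v_1v_2: v_1\in V_1, v_2\in V_2\}$. *)

(* Defs.v *)
From HB Require Import structures.
From mathcomp Require Import all_boot all_order all_algebra.
Set Implicit Arguments.
Unset Strict Implicit.
Unset Printing Implicit Defensive.
Import GRing.Theory Num.Theory.
Local Open Scope ring_scope.

Record sgraph := SGraph {
  vertex :> finType;
  adj : rel vertex;
  adj_sym : symmetric adj;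
  adj_irr : irreflexive adj
}.

Definition edges (G : sgraph) : {set {set G}} :=
  [set [set u; v] | u in G, v in G & adj u v].

Definition degree (G : sgraph) (u : G) : nat := #|[set v | adj u v]|.

(* Every degree is less than #|G|, so the neutral element #|G| does not affect
   the minimum when G has a vertex; the graph with no vertex gets the value 0. *)
Definition min_degree (G : sgraph) : nat :=
  \big[minn/#|G|]_(u : G) degree u.

Definition max_degree (G : sgraph) : nat := \max_(u : G) degree u.

Section Join.
Variables G1 G2 : sgraph.

Definition join_adj (x y : G1 + G2) : bool :=
  match x, y with
  | inl u, inl v => adj u v
  | inr u, inr v => adj u v
  | inl _, inr _ | inr _, inl _ => true
  end.

Lemma join_adj_sym : symmetric join_adj.
Proof. by move=> [u|u] [v|v] //=; rewrite adj_sym. Qed.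

Lemma join_adj_irr : irreflexive join_adj.
Proof. by move=> [u|u] /=; rewrite adj_irr. Qed.

Definition join : sgraph := SGraph join_adj_sym join_adj_irr.
End Join.

(* The weight of an edge {u, v} is symmetric in u and v; it is written as a
   function of the two-element set so that EU is a sum over unordered edges.
   See edge_weight2 for the usual form. *)
Definition edge_weight (R : rcfType) (G : sgraph) (e : {set G}) : R :=
  Num.sqrt (\sum_(w in e) (degree w)%:R ^+ 2 + \prod_(w in e) (degree w)%:R).

Lemma edge_weight2 (R : rcfType) (G : sgraph) (u v : G) : adj u v ->
  edge_weight R [set u; v] =
  Num.sqrt ((degree u)%:R ^+ 2 + (degree v)%:R ^+ 2
            + (degree u)%:R * (degree v)%:R).
Proof.
move=> uv; have neq_uv : u \notin [set v].
  by rewrite inE; apply: contraTneq uv => ->; rewrite adj_irr.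
by rewrite /edge_weight !big_setU1 //= !big_set1.
Qed.

Definition EU (R : rcfType) (G : sgraph) : R :=
  \sum_(e in edges G) edge_weight R e.

(* Main.v *)
(* A vertex of G1 gains #|G2| in degree when passing to the join, and vice
   versa. The edges of the join split into those of G1, those of G2 and the
   n1 n2 cross edges. On each class the weight, being monotone in both degrees,
   is bounded by replacing every degree by its minimum or maximum; for two equal
   degrees d the weight is sqrt 3 * d. *)
Require Import Defs.
From mathcomp Require Import all_boot all_order all_algebra.
Set Implicit Arguments.
Unset Strict Implicit.
Unset Printing Implicit Defensive.
Import GRing.Theory Num.Theory.
Local Open Scope ring_scope.

(** The starting value [#|G|] can only lower the minimum, so induction on the enumeration reaches
    [u] whatever that value is. *)
Lemma min_degree_le (G : sgraph) (u : G) : (min_degree G <= degree u)%N.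
Proof.
rewrite /min_degree; elim: (index_enum G) (mem_index_enum u) => // v s IHs.
rewrite inE big_cons geq_min => /orP[/eqP-> | /IHs ->]; last by rewrite orbT.
by rewrite leqnn.
Qed.

Lemma degree_le_max (G : sgraph) (u : G) : (degree u <= max_degree G)%N.
Proof. exact: (@leq_bigmax G (@degree G)). Qed.

(** Counting neighbours as a sum of ones lets [big_sumType] separate the two sides: the left part is
    the old neighbourhood, the right part is all of [G2]. *)
Lemma degree_joinl (G1 G2 : sgraph) (u : G1) :
  degree (inl u : join G1 G2) = (degree u + #|G2|)%N.
Proof.
rewrite /degree -!sum1dep_card big_sumType /= sum1dep_card; congr addn.
by rewrite sum1_card.
Qed.

Lemma degree_joinr (G1 G2 : sgraph) (u : G2) :
  degree (inr u : join G1 G2) = (degree u + #|G1|)%N.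
Proof.
rewrite /degree -!sum1dep_card big_sumType /= addnC sum1dep_card; congr addn.
by rewrite sum1_card.
Qed.

Lemma edgesP (G : sgraph) (e : {set G}) :
  reflect (exists u v, adj u v /\ e = [set u; v]) (e \in edges G).
Proof.
apply: (iffP imset2P) => [[u v _ uv ->]|[u [v [uv ->]]]].
  by exists u, v; move: uv; rewrite inE => /andP[_ uv].
by exists u v; rewrite ?inE.
Qed.

(** Defined as an image so that counting these edges reduces to injectivity of [inl]. *)
Definition edgesl (G1 G2 : sgraph) : {set {set join G1 G2}} :=
  [set (inl : G1 -> join G1 G2) @: (e : {set G1}) | e in edges G1].

Definition edgesr (G1 G2 : sgraph) : {set {set join G1 G2}} :=
  [set (inr : G2 -> join G1 G2) @: (e : {set G2}) | e in edges G2].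

Definition cross_edge (G1 G2 : sgraph) (p : G1 * G2) : {set join G1 G2} :=
  [set inl p.1; inr p.2].

Definition cross_edges (G1 G2 : sgraph) : {set {set join G1 G2}} :=
  [set cross_edge p | p in [set: G1 * G2]].

Lemma edgeslP (G1 G2 : sgraph) (e : {set join G1 G2}) :
  reflect (exists u v : G1, adj u v /\ e = [set inl u; inl v])
          (e \in edgesl G1 G2).
Proof.
apply: (iffP imsetP) => [[f /edgesP[u [v [uv ->]]] ->]|[u [v [uv ->]]]].
  by exists u, v; split=> //; rewrite imsetU1 imset_set1.
exists [set u; v]; first by apply/edgesP; exists u, v.
by rewrite imsetU1 imset_set1.
Qed.

Lemma edgesrP (G1 G2 : sgraph) (e : {set join G1 G2}) :
  reflect (exists u v : G2, adj u v /\ e = [set inr u; inr v])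
          (e \in edgesr G1 G2).
Proof.
apply: (iffP imsetP) => [[f /edgesP[u [v [uv ->]]] ->]|[u [v [uv ->]]]].
  by exists u, v; split=> //; rewrite imsetU1 imset_set1.
exists [set u; v]; first by apply/edgesP; exists u, v.
by rewrite imsetU1 imset_set1.
Qed.

Lemma cross_edgesP (G1 G2 : sgraph) (e : {set join G1 G2}) :
  reflect (exists (u : G1) (v : G2), e = [set inl u; inr v])
          (e \in cross_edges G1 G2).
Proof.
apply: (iffP imsetP) => [[[u v] _ ->]|[u [v ->]]]; first by exists u, v.
by exists (u, v); rewrite ?inE.
Qed.

Lemma card_edgesl (G1 G2 : sgraph) : #|edgesl G1 G2| = #|edges G1|.
Proof. by apply: card_imset; apply: imset_inj => u v []. Qed.

Lemma card_edgesr (G1 G2 : sgraph) : #|edgesr G1 G2| = #|edges G2|.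
Proof. by apply: card_imset; apply: imset_inj => u v []. Qed.

Lemma card_cross_edges (G1 G2 : sgraph) :
  #|cross_edges G1 G2| = (#|G1| * #|G2|)%N.
Proof.
rewrite card_imset ?cardsT ?card_prod // => -[u v] [u' v'] /setP eq_uv.
(* The tags tell the two ends apart: membership of [inl u] forces [u = u'], and that of [inr v]
   forces [v = v']. *)
move: (eq_uv (inl u)) (eq_uv (inr v)); rewrite !inE !eqxx /= orbF.
by move=> /esym/eqP[->] /esym/eqP[->].
Qed.

Lemma edges_join (G1 G2 : sgraph) :
  edges (join G1 G2) = edgesl G1 G2 :|: edgesr G1 G2 :|: cross_edges G1 G2.
Proof.
apply/setP=> e; rewrite 2!in_setU; apply/edgesP/idP.
  case=> -[u|u] [[v|v]] [] /= uv ->; apply/orP.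
  - by left; apply/orP; left; apply/edgeslP; exists u, v.
  - by right; apply/cross_edgesP; exists u, v.
  - by right; apply/cross_edgesP; exists v, u; rewrite setUC.
  - by left; apply/orP; right; apply/edgesrP; exists u, v.
case/orP=> [/orP[/edgeslP|/edgesrP]|/cross_edgesP].
- by case=> u [v [uv ->]]; exists (inl u), (inl v).
- by case=> u [v [uv ->]]; exists (inr u), (inr v).
- by case=> u [v ->]; exists (inl u), (inr v).
Qed.

Lemma big_disjoint_setU (V : nmodType) (T : finType) (A B : {set T})
    (F : T -> V) :
  [disjoint A & B] ->
  \sum_(x in A :|: B) F x = \sum_(x in A) F x + \sum_(x in B) F x.
Proof. by move=> disjAB; rewrite -bigU //; apply: eq_bigl => x; rewrite !inE. Qed.

Lemma EU_join (R : rcfType) (G1 G2 : sgraph) :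
  EU R (join G1 G2) = \sum_(e in edgesl G1 G2) edge_weight R e
    + \sum_(e in edgesr G1 G2) edge_weight R e
    + \sum_(e in cross_edges G1 G2) edge_weight R e.
Proof.
rewrite /EU edges_join big_disjoint_setU /=; last first.
  (* A cross edge has an end on each side: its right end lies in no edge of [G1], its left end in no
     edge of [G2]. *)
  rewrite disjoint_sym; apply/pred0P=> e /=; apply/negP=> /andP[].
  case/cross_edgesP=> u [v ->] /setUP[/edgeslP|/edgesrP] [a [b [_ /setP eq_e]]].
    by move: (eq_e (inr v)); rewrite !inE eqxx.
  by move: (eq_e (inl u)); rewrite !inE eqxx.
rewrite big_disjoint_setU //; apply/pred0P=> e /=; apply/negP=> /andP[].
case/edgeslP=> u [v [_ ->]] /edgesrP[a [b [_ /setP eq_e]]].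
by move: (eq_e (inl u)); rewrite !inE eqxx.
Qed.

Definition sombor (R : rcfType) (x y : R) : R :=
  Num.sqrt (x ^+ 2 + y ^+ 2 + x * y).

(** Each of the three terms under the root is a product of nonnegative factors, hence monotone. *)
Lemma ler_sombor (R : rcfType) (x y x' y' : R) :
  0 <= x -> 0 <= y -> x <= x' -> y <= y' -> sombor x y <= sombor x' y'.
Proof.
move=> x0 y0 xx' yy'; apply: ler_wsqrtr.
by rewrite !expr2 !lerD // ler_pM.
Qed.

(** The radicand collapses to [3 * x ^+ 2]; this is where the factor [Num.sqrt 3] of the bounds
    comes from. *)
Lemma sombor_diag (R : rcfType) (x : R) : 0 <= x -> sombor x x = Num.sqrt 3 * x.
Proof.
move=> x0; have -> : sombor x x = Num.sqrt (3 * x ^+ 2).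
  by rewrite /sombor -expr2 -mulr2n -mulrSr mulr_natl.
by rewrite sqrtrM ?ler0n // sqrtr_sqr ger0_norm.
Qed.

(** The two ends get independent bounds because those of a cross edge obey different ones. *)
Lemma edge_weight_bounds (R : rcfType) (G : sgraph) (u v : G)
    (a b c d : nat) :
  adj u v -> (a <= degree u <= c)%N -> (b <= degree v <= d)%N ->
  sombor (a%:R : R) b%:R <= edge_weight R [set u; v] <= sombor c%:R d%:R.
Proof.
move=> uv /andP[au uc] /andP[bv vd]; rewrite edge_weight2 //.
by rewrite !ler_sombor ?ler0n ?ler_nat.
Qed.

Lemma sumr_bounds (R : numDomainType) (T : finType) (A : {set T}) (F : T -> R)
    (l h : R) :
  (forall x, x \in A -> l <= F x <= h) ->
  #|A|%:R * l <= \sum_(x in A) F x <= #|A|%:R * h.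
Proof.
move=> lFh; rewrite !mulr_natl -!sumr_const.
by apply/andP; split; apply: ler_sum => x /lFh /andP[].
Qed.

Theorem theorem2 (R : rcfType) (G1 G2 : sgraph) :
  let n1 : R := #|G1|%:R in
  let n2 : R := #|G2|%:R in
  let m1 : R := #|edges G1|%:R in
  let m2 : R := #|edges G2|%:R in
  let d1 : R := (min_degree G1)%:R in
  let d2 : R := (min_degree G2)%:R in
  let D1 : R := (max_degree G1)%:R in
  let D2 : R := (max_degree G2)%:R in
  let alpha1 : R :=
    Num.sqrt 3 * m1 * (d1 + n2) + Num.sqrt 3 * m2 * (d2 + n1)
    + n1 * n2 * Num.sqrt ((d1 + n2) ^+ 2 + (d2 + n1) ^+ 2
                          + (d1 + n2) * (d2 + n1)) in
  let alpha2 : R :=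
    Num.sqrt 3 * m1 * (D1 + n2) + Num.sqrt 3 * m2 * (D2 + n1)
    + n1 * n2 * Num.sqrt ((D1 + n2) ^+ 2 + (D2 + n1) ^+ 2
                          + (D1 + n2) * (D2 + n1)) in
  alpha1 <= EU R (join G1 G2) /\ EU R (join G1 G2) <= alpha2.
Proof.
move=> n1 n2 m1 m2 d1 d2 D1 D2 alpha1 alpha2.
have deg1 (u : G1) : (min_degree G1 + #|G2| <= degree (inl u : join G1 G2)
                       <= max_degree G1 + #|G2|)%N.
  by rewrite degree_joinl !leq_add2r min_degree_le degree_le_max.
have deg2 (u : G2) : (min_degree G2 + #|G1| <= degree (inr u : join G1 G2)
                       <= max_degree G2 + #|G1|)%N.
  by rewrite degree_joinr !leq_add2r min_degree_le degree_le_max.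
have /andP[l1 h1] : m1 * sombor (d1 + n2) (d1 + n2)
    <= \sum_(e in edgesl G1 G2) edge_weight R e
    <= m1 * sombor (D1 + n2) (D1 + n2).
  rewrite /m1 -(card_edgesl G1 G2); apply: sumr_bounds => _ /edgeslP[u [v [uv ->]]].
  (* Folding each sum of casts into the cast of a sum exposes the natural-number bounds of
     [deg1]. *)
  by rewrite -!natrD; apply: edge_weight_bounds.
have /andP[l2 h2] : m2 * sombor (d2 + n1) (d2 + n1)
    <= \sum_(e in edgesr G1 G2) edge_weight R e
    <= m2 * sombor (D2 + n1) (D2 + n1).
  rewrite /m2 -(card_edgesr G1 G2); apply: sumr_bounds => _ /edgesrP[u [v [uv ->]]].
  by rewrite -!natrD; apply: edge_weight_bounds.
have /andP[l3 h3] : n1 * n2 * sombor (d1 + n2) (d2 + n1)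
    <= \sum_(e in cross_edges G1 G2) edge_weight R e
    <= n1 * n2 * sombor (D1 + n2) (D2 + n1).
  rewrite -natrM -card_cross_edges; apply: sumr_bounds => _ /cross_edgesP[u [v ->]].
  by rewrite -!natrD; apply: edge_weight_bounds.
(* Rewriting the [Num.sqrt 3] terms back into [sombor] form makes both bounds match the three class
   estimates term by term. *)
have diag (m x : R) : 0 <= x -> Num.sqrt 3 * m * x = m * sombor x x.
  by move=> x0; rewrite sombor_diag // mulrCA mulrA.
by rewrite EU_join /alpha1 /alpha2 !diag ?addr_ge0 ?ler0n //; split;
  rewrite !lerD.
Qed.
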